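(* Let $X$ be a Tychonoff space and let $\lambda\in\{MC(X),SC(X),CC(X),PS(X),RC(X)\}$. Then the following are equivalent. (1) $C_{p}(X)$ is separable. (2) $C_{c}(X)$ is separable. (3) $X$ has a weaker separable metrizable topology. (4) $C_{\lambda}(X)$ is separable.
   Context: $C(X)$ is the set of all continuous real-valued functions on $X$. For a family $\lambda$ of non-empty subsets of $X$, $C_\lambda(X)$ is $C(X)$ with the $\lambda$-open topology, whose subbase consists of all sets $[F,U]=\{f\in C(X): f(F)\subseteq U\}$ with $F\in\lambda$, $U\subseteq\mathbb{R}$ open. A subset $A\subseteq X$ is a $C$-compact subset of $X$ if $f(A)$ is compact in $\mathbb{R}$ for every $f\in C(X)$. The following denote collections of non-empty subsets of $X$: $MC(X)$ all metrizable compact subsets; $SC(X)$ all sequentially compact subsets; $CC(X)$ all countably compact subsets; $PS(X)$ all pseudocompact subsets; $RC(X)$ all $C$-compact subsets of $X$. $C_p(X)$ and $C_c(X)$ are $C_\lambda(X)$ for $\lambda$ the collection of all non-empty finite, respectively compact, subsets of $X$. ''Weaker topology'' means a topology on the same set that is coarser than or equal to the original one. *)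

(* Defs.v *)
From HB Require Import structures.
From mathcomp Require Import all_boot all_order all_algebra.
From mathcomp Require Import all_classical all_reals all_analysis.

Set Implicit Arguments.
Unset Strict Implicit.
Unset Printing Implicit Defensive.

Import Order.TTheory GRing.Theory Num.Theory.
Import numFieldNormedType.Exports.

Local Open Scope classical_set_scope.
Local Open Scope ring_scope.

Definition separable (T : topologicalType) : Prop :=
  exists2 D : set T, countable D & dense D.

Definition tychonoff_space (T : topologicalType) : Prop :=
  completely_regular_space T /\ hausdorff_space T.

(* A metric structure on the carrier of [T] whose open sets are those of [T] *)
Definition metrizable (R : realType) (T : topologicalType) : Prop :=
  exists m : Metric R T, @open (Metric.Pack m) = @open T.

Definition has_weaker_separable_metrizable_topology
    (R : realType) (X : topologicalType) : Prop :=
  exists t : Topological X, let Y : topologicalType := Topological.Pack t in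
    [/\ @open Y `<=` @open X, separable Y & metrizable R Y].

Definition sequentially_compact (X : topologicalType) (A : set X) : Prop :=
  forall u : nat -> X, (forall n, A (u n)) ->
    exists2 phi : nat -> nat, {homo phi : m n / (m < n)%N} &
      exists2 x, A x & u \o phi @ \oo --> x.

(* Same shape as [cover_compact], restricted to countable covers *)
Definition countably_compact (X : topologicalType) (A : set X) : Prop :=
  forall (D : set nat) (U : nat -> set X), (forall i, D i -> open (U i)) ->
    A `<=` cover D U -> finite_subset_cover D U A.

Definition pseudocompact (R : realType) (T : topologicalType) : Prop :=
  forall f : T -> R, continuous f -> bounded_fun f.

Definition C_compact (R : realType) (X : topologicalType) (A : set X) : Prop :=
  forall f : X -> R, continuous f -> compact (f @` A).

(* In [MC] and [PS], [set_type A] is the subspace [A] of [X] *)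
Definition MC (R : realType) (X : topologicalType) : set (set X) :=
  [set A | [/\ A !=set0, compact A & metrizable R (set_type A)]].
Definition SC (X : topologicalType) : set (set X) :=
  [set A | A !=set0 /\ sequentially_compact A].
Definition CC (X : topologicalType) : set (set X) :=
  [set A | A !=set0 /\ countably_compact A].
Definition PS (R : realType) (X : topologicalType) : set (set X) :=
  [set A | A !=set0 /\ pseudocompact R (set_type A)].
Definition RC (R : realType) (X : topologicalType) : set (set X) :=
  [set A | A !=set0 /\ C_compact R A].

Arguments MC R X : clear implicits.
Arguments SC X : clear implicits.
Arguments CC X : clear implicits.
Arguments PS R X : clear implicits.
Arguments RC R X : clear implicits.

(* The set C(X) of continuous functions, with the [lam]-open topology *)
Definition C_lambda (R : realType) (X : topologicalType)
  (lam : set (set X)) : Type := continuousType X R.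

Section C_lambda_topology.
Context (R : realType) (X : topologicalType) (lam : set (set X)).

HB.instance Definition _ := Choice.on (C_lambda R lam).

HB.instance Definition _ := isSubBaseTopological.Build (C_lambda R lam)
  [set FU : set X * set R | lam FU.1 /\ open FU.2]
  (fun FU => [set f : continuousType X R | f @` FU.1 `<=` FU.2]).

End C_lambda_topology.

Definition C_p (R : realType) (X : topologicalType) : topologicalType :=
  C_lambda R [set A : set X | A !=set0 /\ finite_set A].

Definition C_c (R : realType) (X : topologicalType) : topologicalType :=
  C_lambda R [set A : set X | A !=set0 /\ compact A].

(* Main.v *)
Require Import Defs.
From HB Require Import structures.
From mathcomp Require Import all_boot all_order all_algebra.
From mathcomp Require Import all_classical all_reals all_analysis.
From mathcomp Require Import finmap lra.

Set Implicit Arguments.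
Unset Strict Implicit.
Unset Printing Implicit Defensive.

Import Order.TTheory GRing.Theory Num.Theory.
Import numFieldNormedType.Exports.

Local Open Scope classical_set_scope.
Local Open Scope ring_scope.

(** Every condition is equivalent to the existence of a metric [d] on the set
[X] that is separable and continuous for the topology of [X]; such a metric is
the same thing as a weaker separable metrizable topology
([weaker_separable_metrizableP]). Two implications suffice, because only two
properties of the family [lam] matter: it contains the singletons, and all its
members are C-compact. Both hold for the finite sets, for the compact sets and
for each of the five families.

From separability to a metric ([separable_C_lambda_metric]). If
[{e_0, e_1, ...}] is dense in [C_lambda R lam] and [lam] contains the
singletons, then the [e_n] separate the points of [X], because the continuous
functions on a Tychonoff space do and density passes this on to the [e_n], and
[d x y = sup_n min (1/(n+1), |e_n x - e_n y|)] is the required metric: it is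
the pull-back of a metric of the countable power of the line, a separable
space.

From a metric to separability ([separable_C_lambda]). Let [y] be a
[d]-dense sequence. The functions [min (b, min_i (q_i + k d(., y_(n_i))))],
with rational [b] and [q_i] and natural [k], form a countable subset of
[C(X)], and they approximate every [f] in [C(X)] uniformly on every C-compact
set [F] ([min_cones_dense]). This is the usual approximation by infima of
cones, and it needs two facts: [F] is totally bounded for [d], and [f] is
uniformly continuous on [F] for [d], although it need not be [d]-continuous
on [X]. Both come from a single principle, [C_compactP]: a continuous function
that is positive on a C-compact set is bounded away from zero there. It is
applied to suprema of radii, which are 1-Lipschitz functions of the centre and
therefore continuous; a positive lower bound turns a property that holds near
each point of [F] into a uniform one. Uniform approximation on C-compact sets
gives density because a finite union of C-compact sets is C-compact and each
[f @` A] is a compact subset of the open set in which it is prescribed to lie. *)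

(** * Reals and countable sets *)

(** With [c] the distance of two points, this yields the Lipschitz estimates for
functions that are defined as suprema of sets of radii. *)
Lemma le_supD (R : realType) (A B : set R) (c : R) :
  A !=set0 -> has_ubound B ->
  (forall r, A r -> exists2 s, B s & r <= s + c) -> sup A <= sup B + c.
Proof.
move=> A0 ubB AB; apply: ge_sup => // r /AB[s Bs /le_trans]; apply.
by rewrite lerD2r; exact: ub_le_sup.
Qed.

Lemma exists_natSinv_lt (R : realType) (e : R) : 0 < e -> exists n : nat, n.+1%:R^-1 < e.
Proof.
move=> e0; have [N _ /(_ N (leqnn N))/= NP] := near_infty_natSinv_lt (PosNum e0).
by exists N.
Qed.

Lemma natSinv_gt0 (R : realType) n : 0 < n.+1%:R^-1 :> R.
Proof. by rewrite invr_gt0. Qed.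

Lemma exists_rat_near (R : realType) (a e : R) : 0 < e ->
  exists q : rat, `|ratr q - a| < e.
Proof.
move=> e0; have [|q] := @rat_in_itvoo R (a - e) (a + e).
  by rewrite ltrD2l gtrN.
by rewrite in_itv/= -ltr_distl; exists q.
Qed.

Lemma countable_enumeration (T : Type) (D : set T) :
  D !=set0 -> countable D -> exists e : nat -> T, D = range e.
Proof.
move=> D0 /pfcard_geP[D0'|[e]]; first by move: D0; rewrite D0' => -[].
by exists e; apply/esym; exact: image_eq.
Qed.

(** * C-compact sets *)

(** The form in which C-compactness is used. Forwards, the compact set [g @` A]
has a least element. Backwards, the criterion applied to [1 / (1 + |f|)] shows
that [f @` A] is bounded, and applied to [|f - r|] that a limit point [r] of
[f @` A] belongs to it. *)
Lemma C_compactP (R : realType) (X : topologicalType) (A : set X) :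
  C_compact R A <->
  forall g : X -> R, continuous g -> (forall x, A x -> 0 < g x) ->
    exists2 e : R, 0 < e & forall x, A x -> e <= g x.
Proof.
split=> [cA g gc g0|posA f fc].
  have [[x0 Ax0]|A0] := pselect (A !=set0); last first.
    by exists 1 => // x Ax; case: A0; exists x.
  have [|||c cA' cmin] := @compact_EVT_min R R id (g @` A).
  - by exists (g x0), x0.
  - exact: cA.
  - by apply: continuous_subspaceT => x; exact: cvg_id.
  - have [x1 Ax1 gx1] := set_mem cA'.
    exists c; first by rewrite -gx1 g0.
    by move=> x Ax; apply: cmin; apply: mem_set; exists x.
have [e e0 fe] : exists2 e : R, 0 < e & forall x, A x -> e <= (1 + `|f x|)^-1.
  apply: posA => [x|x _]; last by rewrite invr_gt0 ltr_pwDl.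
  apply: cvgV; first by rewrite gt_eqF// ltr_pwDl.
  by apply: cvgD; [exact: cvg_cst|apply: cvg_norm; exact: fc].
apply: (subclosed_compact _ (@segment_compact R (- e^-1) e^-1)); last first.
  move=> _ [x Ax <-]; have /= := fe x Ax.
  rewrite -[leLHS]invrK lef_pV2 ?posrE ?invr_gt0 ?ltr_pwDl// => ex.
  by rewrite in_itv/= -ler_norml (le_trans _ ex)// lerDr.
move=> r clr; apply: contrapT => nfr.
have [|x Ax|d d0 fd] := posA (fun x => `|f x - r|).
- by move=> x; apply: cvg_norm; apply: cvgB; [exact: fc|exact: cvg_cst].
- by rewrite normr_gt0 subr_eq0; apply/eqP => fxr; apply: nfr; exists x.
- have [_ [[x Ax <-]]] := clr _ (nbhsx_ballx r _ d0).
  by rewrite /ball/= distrC ltNge fd.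
Qed.

Lemma bigcup_C_compact (R : realType) (X : topologicalType) (I : choiceType)
    (D : {fset I}) (F : I -> set X) :
  (forall i, i \in D -> C_compact R (F i)) ->
  C_compact R (\bigcup_(i in [set` D]) F i).
Proof.
move=> cF f fc; rewrite image_bigcup bigcup_fset.
by rewrite big_seq; apply: bigsetU_compact => i /cF; exact.
Qed.

Lemma compact_C_compact (R : realType) (X : topologicalType) (A : set X) :
  compact A -> C_compact R A.
Proof.
by move=> cA f fc; apply: continuous_compact => //; exact: continuous_subspaceT.
Qed.

(** A sequence in [A] along which [g] tends to zero has a subsequence converging
to a point of [A], where [g] would vanish. *)
Lemma sequentially_compact_C_compact (R : realType) (X : topologicalType)
  (A : set X) : sequentially_compact A -> C_compact R A.
Proof.
move=> sA; apply/C_compactP => g gc g0; apply: contrapT => nA.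
have /choice[u uP] : forall n : nat, exists x, A x /\ g x < n.+1%:R^-1.
  move=> n; apply: contrapT => nx; apply: nA.
  exists n.+1%:R^-1; first by rewrite invr_gt0.
  by move=> x Ax; rewrite leNgt; apply/negP => gx; apply: nx; exists x.
have [phi phi_mono [x Ax ux]] := sA u (fun n => (uP n).1).
have phi_ge n : (n <= phi n)%N.
  by elim: n => // n IH; apply: leq_ltn_trans IH _; exact: phi_mono.
have gu : (g \o (u \o phi)) n @[n --> \oo] --> g x by apply: cvg_comp ux _; exact: gc.
suff : g x <= 0 by rewrite leNgt g0.
apply: ler_cvg_to gu (@cvg_harmonic R) _; near=> n; rewrite /=.
apply: (le_trans (ltW (uP (phi n)).2)).
by rewrite lef_pV2 ?posrE// ler_nat ltnS phi_ge.
Unshelve. all: by end_near. Qed.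

(** The open sets on which [g > 1/(n+1)] cover [A]. *)
Lemma countably_compact_C_compact (R : realType) (X : topologicalType)
  (A : set X) : countably_compact A -> C_compact R A.
Proof.
move=> cA; apply/C_compactP => g gc g0.
have [||D _ AD] := cA setT (fun n => [set x | n.+1%:R^-1 < g x]).
- move=> n _; have -> : [set x | n.+1%:R^-1 < g x] = g @^-1` [set r | n.+1%:R^-1 < r].
    by [].
  by apply: open_comp => [x _|]; [exact: gc|exact: open_gt].
- move=> x Ax; have [N NP] := exists_natSinv_lt (g0 x Ax).
  by exists N.
exists (\max_(i <- D) i)%N.+1%:R^-1; first by rewrite invr_gt0.
move=> x /AD[i Di /ltW]; apply: le_trans.
by rewrite lef_pV2 ?posrE// ler_nat ltnS; exact: leq_bigmax_seq.
Qed.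

(** The function [1/g] is continuous on the subspace [A], hence bounded. *)
Lemma pseudocompact_C_compact (R : realType) (X : topologicalType)
  (A : set X) : pseudocompact R (set_type A) -> C_compact R A.
Proof.
move=> pA; apply/C_compactP => g gc g0.
have /pA[M [_ Mb]] : continuous (fun z : set_type A => (g (set_val z))^-1).
  move=> z; apply: cvgV.
  - exact: (@nbhs_filter (set_type A) z).
  - by apply: lt0r_neq0; apply: g0; exact: set_mem (valP z).
  - apply: (@continuous_comp _ _ _ (set_val : set_type A -> X) g).
      exact: initial_continuous.
    exact: gc.
have M0 : 0 < `|M| + 1 by rewrite ltr_pwDr.
exists (`|M| + 1)^-1; first by rewrite invr_gt0.
move=> x Ax; have /= := Mb (`|M| + 1) _ (SigSub (mem_set Ax)) I; rewrite normfV => gM.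
have {}gM : `|g x|^-1 <= `|M| + 1.
  by apply: gM; rewrite (le_lt_trans (ler_norm M))// ltrDl.
rewrite -[leRHS](gtr0_norm (g0 x Ax)) -[leRHS]invrK.
by rewrite lef_pV2// posrE invr_gt0 normr_gt0 lt0r_neq0// g0.
Qed.

(** * Weaker separable metrizable topologies as continuous metrics *)

Section metric_topology.
Context (R : realType) (X : choiceType) (d : X -> X -> R).
Context (dxx : forall x, d x x = 0).
Context (d_eq0 : forall x y, d x y = 0 -> x = y).
Context (dC : forall x y, d x y = d y x).
Context (d_triangle : forall y x z, d x z <= d x y + d y z).

(** A copy of the type without its topology, so that the metric topology does not
compete with one already carried by [X]. *)
Definition metric_copy : Type := X.
HB.instance Definition _ := Choice.on metric_copy.
HB.instance Definition _ := @isMetric.Build R metric_copy d dxx d_eq0 dC d_triangle.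

Lemma metric_of_dist : exists m : Metric R X,
  forall A : set X, @open (Metric.Pack m) A <->
    forall x, A x -> exists2 e : R, 0 < e & forall y, d x y < e -> A y.
Proof.
exists (Metric.class metric_copy) => A.
rewrite openE; split=> oA x /oA.
  by move/nbhs_ballP => [e e0 xeA]; exists e => // y; exact: xeA.
by move=> [e e0 xeA]; apply/nbhs_ballP; exists e.
Qed.

End metric_topology.

(** The continuity of each [d x] says that the topology of [d] is weaker than that
of [X]; the last clause is separability for [d]. *)
Definition continuous_separable_metric (R : realType) (X : topologicalType)
    (d : X -> X -> R) : Prop :=
  [/\ forall x, d x x = 0, forall x y, d x y = 0 -> x = y,
      forall x y, d x y = d y x & forall y x z, d x z <= d x y + d y z] /\
  [/\ forall x, continuous (d x) &
      exists2 D : set X, countable D &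
        forall x e, 0 < e -> exists2 y, D y & d x y < e].

Lemma weaker_separable_metrizableP (R : realType) (X : topologicalType) :
  has_weaker_separable_metrizable_topology R X <->
  exists d : X -> X -> R, continuous_separable_metric d.
Proof.
split=> [[t [tX [D cD dD] [m mt]]]|[d [[dxx d0 dC dT] [dc [D cD dD]]]]].
  pose M : metricType R := Metric.Pack m.
  pose d : X -> X -> R := @mdist R M.
  have openball x e : @open (Topological.Pack t) [set y | d x y < e].
    rewrite -mt openE => y /= dxy.
    apply/nbhs_ballP; exists (e - d x y); rewrite /= ?subr_gt0// => z.
    rewrite ballEmdist /= ltrBrDl; apply: le_lt_trans.
    exact: (@metric_triangle R M).
  exists d; split; split.
  - exact: (@mdistxx R M).
  - exact: (@mdist_positivity R M).
  - exact: (@metric_sym R M).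
  - by move=> *; exact: (@metric_triangle R M).
  - move=> x y; apply/cvgrPdist_lt => e e0.
    have : nbhs y [set z | d y z < e].
      by apply: open_nbhs_nbhs; split; [exact: tX|rewrite /= /d mdistxx].
    apply: filterS => z /= yz; rewrite ltr_norml.
    have zy : d z y < e by rewrite /d metric_sym.
    have yxz : d x y <= d x z + d z y := @metric_triangle R M x z y.
    have zxy : d x z <= d x y + d y z := @metric_triangle R M x y z.
    by apply/andP; split; lra.
  - exists D => // x e e0.
    have [||y [xy Dy]] := dD [set y | d x y < e]; [|exact: openball|by exists y].
    by exists x; rewrite /= /d mdistxx.
have [m mP] := metric_of_dist dxx d0 dC dT.
pose M : metricType R := Metric.Pack m.
exists (Topological.class M); split; last by exists m.
- move=> A /mP oA; rewrite openE => x Ax.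
  have [e e0 xeA] := oA _ Ax.
  have dxxe : d x x < e by rewrite dxx.
  have /cvgr_lt/(_ e dxxe) := dc x x.
  by apply: filterS => y; exact: xeA.
- exists D => // O [x Ox] /mP/(_ x Ox)[e e0 xeO].
  by have [y Dy xy] := dD x e e0; exists y; split => //; exact: xeO.
Qed.

(** The zero distance works, since all topologies on such a type coincide. *)
Lemma metrizable_subsingleton (R : realType) (T : topologicalType) :
  (forall x y : T, x = y) -> metrizable R T.
Proof.
move=> T1.
have [||||m _] := @metric_of_dist R T (fun _ _ => 0);
  [by []|by move=> x y _; exact: T1|by []|by move=> *; rewrite addr0|].
have oT (T' : topologicalType) : (forall x y : T', x = y) -> @open T' = setT.
  move=> T1'; apply/seteqP; split => // A _.
  have [[x Ax]|A0] := pselect (A !=set0).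
    by rewrite (_ : A = setT)//; [exact: openT|apply/seteqP; split => // y _; rewrite (T1' y x)].
  by rewrite (_ : A = set0); [exact: open0|apply/seteqP; split => // y Ay; apply: A0; exists y].
by exists m; rewrite oT// oT.
Qed.

(** * Singletons belong to the five families *)

Lemma set1_MC (R : realType) (X : topologicalType) (x : X) : MC R X [set x].
Proof.
split; [by exists x|exact: compact_set1|apply: metrizable_subsingleton].
by move=> y z; apply: val_inj; rewrite (set_mem (valP y)) (set_mem (valP z)).
Qed.

Lemma set1_SC (X : topologicalType) (x : X) : SC X [set x].
Proof.
split; first by exists x.
move=> u ux; exists id => //; exists x => //.
by rewrite (_ : u = cst x); [exact: cvg_cst|apply/funext => n; exact: ux].
Qed.

Lemma set1_CC (X : topologicalType) (x : X) : CC X [set x].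
Proof.
split; first by exists x.
move=> D U _ /(_ x erefl)[n Dn Unx]; exists [fset n]%fset.
  by move=> k; rewrite in_fset1 => /eqP ->; exact: mem_set.
by move=> _ ->; exists n => //=; rewrite in_fset1.
Qed.

Lemma set1_PS (R : realType) (X : topologicalType) (x : X) : PS R X [set x].
Proof.
split; first by exists x.
move=> f _; exists `|f (SigSub (mem_set erefl))|; split; first exact: num_real.
move=> M fM y _ /=; apply: ltW.
rewrite (_ : y = SigSub (mem_set (erefl : [set x] x)))//.
by apply: val_inj; rewrite /= (set_mem (valP y)).
Qed.

Lemma set1_RC (R : realType) (X : topologicalType) (x : X) : RC R X [set x].
Proof.
by split; [exists x|apply: compact_C_compact; exact: compact_set1].
Qed.

(** * The metric of a point-separating sequence of functions *)

Section sequence_metric.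
Context (R : realType) (X : topologicalType) (e : nat -> X -> R).

Definition truncated_gap (x y : X) (n : nat) : R :=
  Num.min n.+1%:R^-1 `|e n x - e n y|.

Definition sequence_dist (x y : X) : R := sup (range (truncated_gap x y)).

Lemma sequence_dist_ub x y n : truncated_gap x y n <= sequence_dist x y.
Proof.
apply: ub_le_sup; last by exists n.
by exists 1 => _ [k _ <-]; rewrite /truncated_gap ge_min invf_le1 ?ltr0n// ler1n.
Qed.

Lemma sequence_dist_le x y c :
  (forall n, truncated_gap x y n <= c) -> sequence_dist x y <= c.
Proof.
move=> gc; apply: ge_sup; first by exists (truncated_gap x y 0), 0.
by move=> _ [n _ <-].
Qed.

(** The truncation at [1/(n+1)] makes only finitely many of the functions matter at
a given scale; continuity and separability of the distance both rest on this. *)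
Lemma sequence_dist_le_head x y (N : nat) c : N.+1%:R^-1 <= c ->
  (forall n, (n < N)%N -> `|e n x - e n y| <= c) -> sequence_dist x y <= c.
Proof.
move=> Nc hc; apply: sequence_dist_le => n; rewrite /truncated_gap ge_min.
have [nN|Nn] := ltnP n N; first by rewrite hc ?orbT.
apply/orP; left; apply: le_trans Nc.
by rewrite lef_pV2 ?posrE// ler_nat ltnS.
Qed.

Lemma sequence_distxx x : sequence_dist x x = 0.
Proof.
apply/eqP; rewrite eq_le; apply/andP; split.
  by apply: sequence_dist_le => n; rewrite /truncated_gap subrr normr0 ge_min lexx orbT.
apply: (le_trans _ (sequence_dist_ub x x 0)).
by rewrite /truncated_gap le_min normr_ge0 invr_ge0 ler0n.
Qed.

Lemma sequence_distC x y : sequence_dist x y = sequence_dist y x.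
Proof.
rewrite /sequence_dist (_ : truncated_gap x y = truncated_gap y x)//.
by apply/funext => n; rewrite /truncated_gap distrC.
Qed.

Lemma sequence_dist_triangle y x z :
  sequence_dist x z <= sequence_dist x y + sequence_dist y z.
Proof.
apply: sequence_dist_le => n.
apply: (le_trans _ (lerD (sequence_dist_ub x y n) (sequence_dist_ub y z n))).
rewrite /truncated_gap; have := natSinv_gt0 R n.
have := ler_distD (e n y) (e n x) (e n z).
have := normr_ge0 (e n x - e n y); have := normr_ge0 (e n y - e n z).
set a := `|e n x - e n y|; set b := `|e n y - e n z|; set c := `|_|; set i := _^-1.
move=> a0 b0 abc i0; rewrite ge_min.
have [ia|ia] := leP i a; have [ib|ib] := leP i b; apply/orP.
all: by (left; lra) || (right; lra).
Qed.

Lemma sequence_dist_metric :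
  (forall n, continuous (e n)) ->
  (forall x y, (forall n, e n x = e n y) -> x = y) ->
  continuous_separable_metric sequence_dist.
Proof.
move=> ec esep; split; split.
- exact: sequence_distxx.
- move=> x y dxy; apply: esep => n; have := sequence_dist_ub x y n.
  rewrite dxy /truncated_gap ge_min leNgt natSinv_gt0/= normr_le0 subr_eq0.
  by move/eqP.
- exact: sequence_distC.
- exact: sequence_dist_triangle.
- move=> x y; apply/cvgrPdist_lt => c c0.
  have c20 : 0 < c / 2 by rewrite divr_gt0.
  have [N Nc] := exists_natSinv_lt c20.
  have : \forall z \near y, forall n : 'I_N, `|e n y - e n z| <= c / 2.
    by apply: filter_forall => n; have /cvgrPdist_le := ec n y; exact.
  apply: filterS => z yz.
  have dyz : sequence_dist y z <= c / 2.
    by apply: (@sequence_dist_le_head _ _ N) => [|n nN]; [exact: ltW|exact: (yz (Ordinal nN))].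
  have := sequence_dist_triangle z x y; have := sequence_dist_triangle y x z.
  by rewrite (sequence_distC z y) ltr_norml => ? ?; apply/andP; split; lra.
- have [[x0 _]|X0] := pselect ([set: X] !=set0); last first.
    by exists set0 => // x; case: X0; exists x.
  (* Points are indexed by rational approximations to the values of the first
     functions of the sequence; one point is chosen for each realised index. *)
  pose S (c : nat * seq rat) := [set x | forall n, (n < c.1)%N ->
    `|e n x - ratr (nth 0 c.2 n)| <= c.1.+1%:R^-1].
  exists (range (fun c => xget x0 (S c))) => [|x c c0].
    exact: sub_countable (card_image_le _ _) (countableP _).
  have c20 : 0 < c / 2 by rewrite divr_gt0.
  have [N Nc] := exists_natSinv_lt c20.
  have /choice[q qP] : forall n, exists q : rat, `|e n x - ratr q| <= N.+1%:R^-1.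
    move=> n; have [q /ltW eq] := exists_rat_near (e n x) (natSinv_gt0 R N).
    by exists q; rewrite distrC.
  pose s := mkseq q N.
  have Sx : S (N, s) x by move=> n nN; rewrite nth_mkseq.
  have Sy := @xgetPex _ x0 (S (N, s)) (ex_intro _ _ Sx).
  exists (xget x0 (S (N, s))); first by exists (N, s).
  set y := xget _ _ in Sy *.
  apply: (@le_lt_trans _ _ (N.+1%:R^-1 + N.+1%:R^-1)); last first.
    by rewrite [ltRHS]splitr ltrD.
  apply: (@sequence_dist_le_head _ _ N) => [|n nN].
    by rewrite lerDl ltW// natSinv_gt0.
  apply: le_trans (ler_distD (ratr (nth 0 s n)) _ _) _.
  by rewrite lerD//; [exact: Sx|rewrite distrC; exact: Sy].
Qed.

End sequence_metric.

(** * From a countable dense set of functions to a metric *)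

Lemma tychonoff_separates (R : realType) (X : topologicalType) (x y : X) :
  tychonoff_space X -> x <> y ->
  exists f : X -> R, [/\ continuous f, f x = 0 & f y = 1].
Proof.
move=> [crX hX] xy.
have cly : closed [set y]
  by exact/accessible_closed_set1/hausdorff_accessible.
have [f [fc _ f0 f1]] := (@uniform_separatorP _ R _ _).1 (crX x [set y] cly xy).
exists f; split => //; [by apply: f0; exists x|by apply: f1; exists y].
Qed.

Section C_lambda_lemmas.
Context (R : realType) (X : topologicalType) (lam : set (set X)).

Lemma C_lambda_open_subbase (A : set X) (U : set R) : lam A -> open U ->
  @open (C_lambda R lam) [set f : continuousType X R | f @` A `<=` U].
Proof.
move=> lA oU; rewrite /open /=.
exists [set [set f : continuousType X R | f @` A `<=` U]].
  move=> _ ->; exact: (@finI_from1 _ _ [set FU : set X * set R | lam FU.1 /\ open FU.2]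
    (fun FU => [set f : continuousType X R | f @` FU.1 `<=` FU.2]) (A, U)).
by rewrite bigcup_set1.
Qed.

Lemma C_lambda_open_base (O : set (C_lambda R lam)) (f : continuousType X R) :
  open O -> O f ->
  exists D : {fset (set X * set R)},
    (forall FU, FU \in D -> [/\ lam FU.1, open FU.2 & f @` FU.1 `<=` FU.2]) /\
    (forall g : continuousType X R,
      (forall FU, FU \in D -> g @` FU.1 `<=` FU.2) -> O g).
Proof.
rewrite /open /= => -[B Bfin <-] [b Bb bf].
have [D Dsub Db] := Bfin _ Bb.
exists D; split=> [FU DFU|g gD].
  have [lF oU] := set_mem (Dsub _ DFU).
  by split=> //; move: bf; rewrite -Db; exact.
by exists b => //; rewrite -Db /= => FU DFU; exact: gD.
Qed.

(** The subbasic open sets given by two distinct points and the half-lines below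
and above 1/2 meet in a nonempty open set, so some member of the dense set
separates the two points. *)
Lemma separable_C_lambda_metric : tychonoff_space X ->
  (forall x, lam [set x]) -> separable (C_lambda R lam) ->
  exists d : X -> X -> R, continuous_separable_metric d.
Proof.
move=> tX lam1 [D cD dD].
have zc : continuous (fun _ : X => 0 : R) by move=> x; exact: cvg_cst.
have D0 : D !=set0.
  have [||f [_ Df]] := dD setT; [|exact: openT|by exists f].
  by exists (mkcts zc : continuousType X R).
have [e De] := countable_enumeration D0 cD.
pose e' n : X -> R := (e n : continuousType X R).
exists (sequence_dist e'); apply: sequence_dist_metric => [n|x y exy].
  exact: (@cts_fun _ _ (e n : continuousType X R)).
apply: contrapT => xy; have [f [fc fx fy]] := tychonoff_separates R tX xy.
have [||g [[gx gy]]] := dD ([set h : continuousType X R | h @` [set x] `<=` [set r | r < 1/2]]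
    `&` [set h : continuousType X R | h @` [set y] `<=` [set r | 1/2 < r]]).
- exists (mkcts fc : continuousType X R); split => /= _ [_ -> <-].
    by rewrite /mkcts fx /=; lra.
  by rewrite /mkcts fy /=; lra.
- by apply: openI; apply: C_lambda_open_subbase;
    [exact: lam1|exact: open_lt|exact: lam1|exact: open_gt].
rewrite De => -[n _ eg]; have := exy n; rewrite /e' eg => gxy.
have := gx _ (imageP _ erefl); have := gy _ (imageP _ erefl).
by rewrite /= gxy => gt2 /(lt_trans gt2); rewrite ltxx.
Qed.

End C_lambda_lemmas.

(** * Uniform approximation on C-compact sets *)

Section metric_lemmas.
Context (R : realType) (X : topologicalType) (d : X -> X -> R).
Context (dP : continuous_separable_metric d).

Let dxx x : d x x = 0. Proof. by case: dP => [[]]. Qed.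
Let d_eq0 x z : d x z = 0 -> x = z. Proof. by case: dP => [[_ + _ _] _]; exact. Qed.
Let dC x z : d x z = d z x. Proof. by case: dP => [[]]. Qed.
Let d_triangle z x t : d x t <= d x z + d z t. Proof. by case: dP => [[]]. Qed.
Let d_continuous x : continuous (d x). Proof. by case: dP => [_ []]. Qed.
Let d_ge0 x z : 0 <= d x z.
Proof. by have := d_triangle z x x; rewrite dxx (dC z x); lra. Qed.

Lemma lipschitz_continuous (g : X -> R) :
  (forall x z, g x <= g z + d x z) -> continuous g.
Proof.
move=> gL x; apply/cvgrPdist_lt => e e0.
have dxe : d x x < e by rewrite dxx.
have /cvgr_lt/(_ e dxe) := @d_continuous x x.
apply: filterS => z xz; have := gL x z; have := gL z x.
by rewrite (dC z x) ltr_norml => ? ?; apply/andP; split; lra.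
Qed.

(** The modulus [sup (W x)], the supremum of the radii up to [1] of [d]-balls
around [x] in which [f] oscillates by less than [e] on [F], is 1-Lipschitz in [x], so it is
continuous and [C_compactP] bounds it from below once it is positive on [F].
Positivity at a point [x] of [F] is continuity of [f] at [x] for [d] restricted
to [F]; it follows from [C_compactP] as well, because the maximum of [d x z] and
[e/2 - |f z - f x|] cannot vanish: [d x z = 0] forces [z = x]. *)
Lemma C_compact_uniform_continuity (F : set X) (f : X -> R) (e : R) :
  C_compact R F -> continuous f -> 0 < e ->
  exists2 del : R, 0 < del &
    forall u v, F u -> F v -> d u v < del -> `|f u - f v| < e.
Proof.
move=> /C_compactP cF fc e0.
(* The radius 0 is always admissible, so that the suprema are those of nonempty
   sets even at points away from [F]. *)
pose W x : set R := [set r | 0 <= r <= 1 /\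
  forall u v, F u -> F v -> d x u < r -> d x v < r -> `|f u - f v| < e].
have W0 x : W x 0.
  by split=> [|u v _ _]; [rewrite lexx ler01|rewrite ltNge d_ge0].
have ubW x : has_ubound (W x) by exists 1 => r [/andP[]].
have e20 : 0 < e / 2 by rewrite divr_gt0.
have [|x Fx|c c0 cW] := cF (fun x => sup (W x)).
- apply: lipschitz_continuous => x z; apply: le_supD => [|//|r [/andP[r0 r1] Wr]].
    by exists 0.
  have [rxz|xzr] := leP r (d x z).
    by exists 0; rewrite ?add0r.
  exists (r - d x z); last by rewrite subrK.
  split=> [|u v Fu Fv zu zv].
    by have := d_ge0 x z; move=> ?; apply/andP; split; lra.
  have := d_triangle z x u; have := d_triangle z x v => ? ?.
  by apply: Wr => //; lra.
- have [||r r0 xr] := cF (fun z => Num.max (d x z) (e / 2 - `|f z - f x|)).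
  + move=> z; apply: (@continuous_max R X (d x) (fun z => e / 2 - `|f z - f x|)).
      exact: d_continuous.
    apply: cvgB; first exact: cvg_cst.
    by apply: cvg_norm; apply: cvgB; [exact: fc|exact: cvg_cst].
  + move=> z Fz; rewrite lt_max; have [zx|zx] := eqVneq (d x z) 0.
      by rewrite -(d_eq0 zx) subrr normr0 subr0 e20 orbT.
    by rewrite lt_neqAle eq_sym zx d_ge0.
  + apply: (@lt_le_trans _ _ (Num.min 1 r)); first by rewrite lt_min ltr01.
    apply: ub_le_sup => //; split.
      by rewrite le_min ler01 ltW//= ge_min lexx.
    have xle u : F u -> d x u < Num.min 1 r -> `|f u - f x| < e / 2.
      move=> Fu; rewrite lt_min => /andP[_ xur].
      have := xr u Fu; rewrite le_max leNgt xur/= => ru; lra.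
    move=> u v Fu Fv /(xle u Fu) ux /(xle v Fv) vx.
    rewrite [ltRHS]splitr; apply: le_lt_trans (ler_distD (f x) _ _) _.
    by rewrite ltrD// distrC.
- have c20 : 0 < c / 2 by rewrite divr_gt0.
  exists (c / 2) => // u v Fu Fv uv.
  have [||r [_ Wr] cr] := @sup_gt _ (W u) (c / 2); first by exists 0.
    by apply: (lt_le_trans _ (cW u Fu)); lra.
  by apply: Wr => //; [rewrite dxx|]; apply: lt_trans cr.
Qed.

Context (y : nat -> X) (yP : forall x e, 0 < e -> exists n, d x (y n) < e).

(** The weights [1/(n+1)] make the supremum over [n] record which of the balls
around the [y n] contain the point: a lower bound [c] for it on [F] can only be
reached by indices with [1/(n+1) > c], a finite set. *)
Lemma C_compact_totally_bounded (F : set X) (eta : R) :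
  C_compact R F -> 0 < eta ->
  exists N : nat, forall x, F x -> exists2 n, (n < N)%N & d x (y n) < eta.
Proof.
move=> /C_compactP cF eta0.
pose h x n : R := Num.min n.+1%:R^-1 (Num.max 0 (eta - d x (y n))).
have ubh x : has_ubound (range (h x)).
  by exists 1 => _ [k _ <-]; rewrite /h ge_min invf_le1 ?ltr0n// ler1n.
have h0 x : range (h x) !=set0 by exists (h x 0), 0.
have [|x Fx|c c0 ch] := cF (fun x => sup (range (h x))).
- apply: lipschitz_continuous => x z; apply: le_supD => // _ [n _ <-].
  exists (h z n) => //; rewrite /h.
  have := d_triangle x z (y n); rewrite (dC z x) => zxy.
  have xz0 := d_ge0 x z.
  rewrite addr_minl addr_maxl add0r le_min; apply/andP; split.
    by rewrite ge_min lerDl xz0.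
  rewrite ge_min; apply/orP; right; rewrite ge_max !le_max.
  by apply/andP; split; apply/orP; [left|right; lra].
- have [n xn] := yP x eta0; apply: (@lt_le_trans _ _ (h x n)).
    by rewrite /h lt_min natSinv_gt0/= lt_max subr_gt0 xn orbT.
  by apply: ub_le_sup => //; exists n.
- have [N Nc] := exists_natSinv_lt c0.
  exists N => x Fx.
  have [_ [n _ <-]] := @sup_gt _ _ N.+1%:R^-1 (h0 x) (lt_le_trans Nc (ch x Fx)).
  rewrite /h lt_min lt_max => /andP[Nn]; rewrite ltNge ltW ?natSinv_gt0//= => hn.
  exists n; first by move: Nn; rewrite ltf_pV2 ?posrE// ltr_nat ltnS.
  by rewrite -subr_gt0; apply: lt_trans hn; exact: natSinv_gt0.
Qed.

(** The leading rational is an upper cut-off, which makes the minimum meaningful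
for the empty list of cones. *)
Definition min_cones (c : rat * nat * seq (rat * nat)) (x : X) : R :=
  \big[Num.min/ratr c.1.1]_(p <- c.2) (ratr p.1 + c.1.2%:R * d x (y p.2)).

Lemma continuous_min_cones c : continuous (min_cones c).
Proof.
case: c => -[b k] s; rewrite /min_cones/=; elim: s => [|p s IH] x.
  by under eq_fun do rewrite big_nil; exact: cvg_cst.
under eq_fun do rewrite big_cons.
apply: (@continuous_min R X (fun x => ratr p.1 + k%:R * d x (y p.2))); last exact: IH.
apply: cvgD; first exact: cvg_cst.
apply: cvgMr; under eq_fun do rewrite dC; rewrite dC; exact: d_continuous.
Qed.

(** With [t] small, [f u <= f v + t + k d(u,v)] on [F] for some slope [k]: for close
points by uniform continuity, for the others because [f] is bounded. Take
finitely many [y n] within [t/k] of [F] that cover [F] at that scale, and cones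
of slope [k] with vertex value [q n] close to the value of [f] at a point of [F]
near [y n]. No cone falls more than [3t] below [f] on [F], and at [x] the cone
whose vertex is within [t/k] of [x] exceeds [f x] by less than [5t]. *)
Lemma min_cones_dense (F : set X) (f : X -> R) (e : R) :
  C_compact R F -> continuous f -> 0 < e ->
  exists c, forall x, F x -> `|min_cones c x - f x| < e.
Proof.
move=> cF fc e0; pose t := e / 6; have t0 : 0 < t by rewrite divr_gt0.
have [M Mf] : exists M, forall x, F x -> `|f x| <= M.
  have [M [_ /(_ (M + 1))]] := compact_bounded (cF f fc).
  by rewrite ltrDl => /(_ ltr01) Mf; exists (M + 1) => x Fx; apply: Mf; exists x.
have [del del0 fdel] := C_compact_uniform_continuity cF fc t0.
pose k := (Num.truncn (2 * M / del)).+1.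
have k0 : 0 < k%:R :> R by rewrite ltr0n.
have fk u v : F u -> F v -> f u <= f v + t + k%:R * d u v.
  move=> Fu Fv; have [uv|uv] := ltP (d u v) del.
    have := fdel u v Fu Fv uv; rewrite ltr_norml => /andP[_ fuv].
    by have : 0 <= k%:R * d u v; [rewrite mulr_ge0|lra].
  have : 2 * M <= k%:R * d u v.
    apply: (@le_trans _ _ (k%:R * del)); last by rewrite ler_pM2l.
    by rewrite -ler_pdivrMr// ltW// truncnS_gt.
  have := Mf u Fu; have := Mf v Fv; rewrite !ler_norml.
  by move=> /andP[? ?] /andP[? ?] ?; lra.
have eta0 : 0 < t / k%:R by rewrite divr_gt0.
have [N NF] := C_compact_totally_bounded cF eta0.
pose near_F n := exists2 x, F x & d x (y n) < t / k%:R.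
have /choice[q qP] : forall n, exists q : rat, near_F n ->
    exists x, [/\ F x, k%:R * d x (y n) < t & `|ratr q - f x| < t].
  move=> n; have [[x Fx xn]|nF] := pselect (near_F n); last by exists 0.
  have [q fq] := exists_rat_near (f x) t0.
  by exists q => _; exists x; split; rewrite // mulrC -ltr_pdivlMr.
have [b bM] := exists_rat_near (M + t) t0.
(* The cut-off [b] exceeds [f] on [F]. *)
exists (b, k, [seq (q n, n) | n <- iota 0 N & `[< near_F n >]]) => x Fx.
apply: (@le_lt_trans _ _ (5 * t)); last by rewrite /t; lra.
rewrite /min_cones/= big_map; rewrite ler_distl; apply/andP; split.
  rewrite big_seq; apply: le_bigmin.
    have := Mf x Fx; move: bM; rewrite ler_norml ltr_norml.
    by move=> /andP[? ?] /andP[? ?]; lra.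
  move=> n; rewrite mem_filter => /andP[/asboolP/qP[z [Fz zn]]].
  rewrite ltr_norml => /andP[qz _] _.
  have := fk x z Fx Fz; have : k%:R * d x z <= k%:R * d x (y n) + k%:R * d z (y n).
    by rewrite -mulrDr ler_pM2l// (dC z); exact: d_triangle.
  by move=> ? ?; rewrite /=; lra.
have [n nN xn] := NF x Fx.
have nearn : near_F n by exists x.
have [z [Fz zn]] := qP n nearn; rewrite ltr_norml => /andP[_ qz].
apply: (@bigmin_inf_seq _ _ _ _ _ n) => //.
  by rewrite mem_filter mem_iota /= nN; apply/andP; split => //; apply/asboolP.
have : k%:R * d x (y n) < t by rewrite mulrC -ltr_pdivlMr.
have := fk z x Fz Fx; have : k%:R * d z x <= k%:R * d z (y n) + k%:R * d x (y n).
  by rewrite -mulrDr ler_pM2l// (dC x); exact: d_triangle.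
by move=> ? ? ? /=; lra.
Qed.

(** A basic neighbourhood of [f] prescribes open sets [U] for finitely many [A] in
[lam]. As [f @` A] is compact, all sufficiently small radii keep the
neighbourhood of [f @` A] of that radius inside [U]; approximating [f] within
such a radius on the union of the sets [A] lands in the neighbourhood. *)
Lemma separable_C_lambda_of_dense_sequence (lam : set (set X)) :
  (forall A, lam A -> C_compact R A) -> separable (C_lambda R lam).
Proof.
move=> lamC.
pose g c : C_lambda R lam := mkcts (@continuous_min_cones c) : continuousType X R.
exists (range g) => [|O [f Of] oO].
  exact: sub_countable (card_image_le _ _) (countableP _).
have [D [DP DO]] := C_lambda_open_base oO Of.
have fc : continuous (f : continuousType X R) by exact: cts_fun.
have cF : C_compact R (\bigcup_(FU in [set` D]) FU.1).
  by apply: bigcup_C_compact => FU /DP[/lamC].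
have : \forall r \near (0:R)^'+, (\bigcap_(FU in [set` D])
    [set r : R | forall s, ((f : continuousType X R) @` FU.1) s -> ball s r `<=` FU.2]) r.
  apply: filter_bigI => FU /DP[lF oU fFU].
  have /compact_near_coveringP cfF := lamC _ lF _ fc.
  apply: (cfF R ((0:R)^'+) (fun r s => ball s r `<=` FU.2)) => s /fFU Us.
  have /nbhs_ballP[r /= r0 rU] := open_nbhs_nbhs (conj oU Us).
  have r20 : 0 < r / 2 by rewrite divr_gt0.
  near=> s' r'.
  have r'2 : r' <= r / 2 by near: r'; exact: nbhs_right_le.
  have ss' : ball s (r / 2) s' by near: s'; exact: nbhsx_ballx.
  move=> t r't; apply: rU.
  rewrite [r]splitr; apply: (ball_triangle ss'); exact: le_ball r't.
move=> /(filterI (nbhs_right_gt 0))/filter_ex[r [/= r0 rU]].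
have [c cf] := min_cones_dense cF fc r0.
exists (g c); split; last by exists c.
apply: DO => FU DFU _ [x Fx <-]; apply: (rU FU DFU (f x)); first by exists x.
by rewrite /ball/= distrC; apply: cf; exists FU.
Unshelve. all: by end_near. Qed.

End metric_lemmas.

(** * Equivalence of the four conditions *)

(** A dense sequence of points requires an inhabited space. *)
Lemma separable_C_lambda_empty (R : realType) (X : topologicalType)
  (lam : set (set X)) : ~ ([set: X] !=set0) -> separable (C_lambda R lam).
Proof.
move=> X0; pose z : C_lambda R lam := mkcts (@cst_continuous X R 0) : continuousType X R.
exists [set z]; first exact: countable1.
move=> O [f Of] _; exists f; split => //; apply/continuousEP => x.
by case: X0; exists x.
Qed.

Lemma separable_C_lambda (R : realType) (X : topologicalType)
    (d : X -> X -> R) (lam : set (set X)) :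
  continuous_separable_metric d -> (forall A, lam A -> C_compact R A) ->
  separable (C_lambda R lam).
Proof.
move=> dP lamC; have [X0|] := pselect ([set: X] !=set0); last first.
  exact: separable_C_lambda_empty.
have [_ [_ [D cD dD]]] := dP.
have D0 : D !=set0 by case: X0 => x _; have [z Dz _] := dD x 1 ltr01; exists z.
have [y Dy] := countable_enumeration D0 cD.
apply: (separable_C_lambda_of_dense_sequence dP (y := y)) => // x e e0.
by have [z] := dD x e e0; rewrite Dy => -[n _ <-] ?; exists n.
Qed.

Theorem theorem6p1 (R : realType) (X : topologicalType) (lam : set (set X)) :
  tychonoff_space X ->
  [set MC R X; SC X; CC X; PS R X; RC R X] lam ->
  [<-> separable (C_p R X);
       separable (C_c R X);
       has_weaker_separable_metrizable_topology R X;
       separable (C_lambda R lam)].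
Proof.
move=> tX lamE.
have [lam1 lamC] : (forall x, lam [set x]) /\ (forall A, lam A -> C_compact R A).
  move: lamE => [[[[|]|]|]|] ->; split=> [x|A].
  - exact: set1_MC.
  - by case=> _ /compact_C_compact.
  - exact: set1_SC.
  - by case=> _ /sequentially_compact_C_compact.
  - exact: set1_CC.
  - by case=> _ /countably_compact_C_compact.
  - exact: set1_PS.
  - by case=> _ /pseudocompact_C_compact.
  - exact: set1_RC.
  - by case.
tfae.
- move/separable_C_lambda_metric => /(_ tX)[x|d dP].
    by split; [exists x|exact: finite_set1].
  by apply: (separable_C_lambda dP) => A [_ /compact_C_compact].
- move/separable_C_lambda_metric => /(_ tX)[x|d dP].
    by split; [exists x|exact: compact_set1].
  by apply/weaker_separable_metrizableP; exists d.
- by move=> /weaker_separable_metrizableP[d dP]; exact: separable_C_lambda dP lamC.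
- move/separable_C_lambda_metric => /(_ tX lam1)[d dP].
  by apply: (separable_C_lambda dP) => A [_ /finite_compact/compact_C_compact].
Qed.
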